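(* Assume the Continuum Hypothesis $2^{\aleph_0}=\aleph_1$. Let $p$ be a prime, let $A_p$ be a countable (countably infinite) elementary abelian $p$-group, let $R={\rm End}(A_p)$, and let $I=\{\alpha\in R : |{\rm Im}(\alpha)|<\aleph_0\}$, the ideal of $R$ consisting of all endomorphisms with finite image. Then the factor ring $R/I$ does not admit a nondiscrete locally compact ring topology.
   Context: An abelian group $A$ is an elementary abelian $p$-group if $pa=0$ for all $a\in A$. ${\rm End}(A)$ is the ring of all additive endomorphisms of $A$ under pointwise addition and composition. A ring topology on a ring is a topology for which addition, negation and multiplication are (jointly) continuous; all topologies considered are assumed completely regular, in particular Hausdorff. *)

(* Defs.v *)
From HB Require Import structures.
From mathcomp Require Import all_boot all_algebra generic_quotient.
From mathcomp Require Import all_classical wochoice.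
From mathcomp Require Import topology urysohn.

Set Implicit Arguments.
Unset Strict Implicit.
Unset Printing Implicit Defensive.

Import GRing.Theory.

Local Open Scope classical_set_scope.
Local Open Scope ring_scope.
Local Open Scope quotient_scope.

(* Having cardinality aleph_1 means carrying a well-order of type omega_1:
   T is uncountable, but all its initial segments are countable. *)
Definition has_card_aleph1 (T : Type) : Prop :=
  exists R : rel T, [/\ well_order R, ~ countable [set: T] &
    forall x, countable [set y | R y x]].

Definition continuum_hypothesis : Prop := has_card_aleph1 (set nat).

Definition elementary_abelian (p : nat) (A : zmodType) : Prop :=
  forall a : A, a *+ p = 0.

Definition endo (A : zmodType) : Type := {additive A -> A}.

Section EndoRing.
Variable A : zmodType.

Lemma endoP (f g : endo A) : f =1 g -> f = g.
Proof.
case: f g => f [[fm]] [g [[gm]]] /= /funext fg.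
by case: _ / fg in gm *; rewrite (Prop_irrelevance fm gm).
Qed.

HB.instance Definition _ := gen_eqMixin (endo A).
HB.instance Definition _ := gen_choiceMixin (endo A).

Definition endo_zero : endo A := (\0 : A -> A) : {additive A -> A}.
Definition endo_opp (f : endo A) : endo A := (\- f) : {additive A -> A}.
Definition endo_add (f g : endo A) : endo A := (f \+ g) : {additive A -> A}.
Definition endo_one : endo A := (@idfun A) : {additive A -> A}.
Definition endo_mul (f g : endo A) : endo A := (f \o g) : {additive A -> A}.

Lemma endo_addA : associative endo_add.
Proof. by move=> f g h; apply: endoP => x /=; rewrite addrA. Qed.

Lemma endo_addC : commutative endo_add.
Proof. by move=> f g; apply: endoP => x /=; rewrite addrC. Qed.

Lemma endo_add0 : left_id endo_zero endo_add.
Proof. by move=> f; apply: endoP => x /=; rewrite add0r. Qed.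

Lemma endo_addN : left_inverse endo_zero endo_opp endo_add.
Proof. by move=> f; apply: endoP => x /=; rewrite addNr. Qed.

HB.instance Definition _ :=
  GRing.isZmodule.Build (endo A) endo_addA endo_addC endo_add0 endo_addN.

Lemma endo_mulA : associative endo_mul.
Proof. by move=> f g h; apply: endoP. Qed.

Lemma endo_mul1l : left_id endo_one endo_mul.
Proof. by move=> f; apply: endoP. Qed.

Lemma endo_mul1r : right_id endo_one endo_mul.
Proof. by move=> f; apply: endoP. Qed.

Lemma endo_mulDl : left_distributive endo_mul +%R.
Proof. by move=> f g h; apply: endoP. Qed.

Lemma endo_mulDr : right_distributive endo_mul +%R.
Proof. by move=> f g h; apply: endoP => x /=; rewrite raddfD. Qed.

HB.instance Definition _ := GRing.Zmodule_isPzRing.Build (endo A)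
  endo_mulA endo_mul1l endo_mul1r endo_mulDl endo_mulDr.

End EndoRing.

(* The library's quotient rings are restricted to commutative rings. *)
HB.mixin Record isTwoSidedMulClosed (R : pzRingType) (S : R -> bool) := {
  ideal_mull : forall a u : R, u \in S -> a * u \in S;
  ideal_mulr : forall a u : R, u \in S -> u * a \in S
}.

#[short(type="twoSidedIdeal")]
HB.structure Definition TwoSidedIdeal (R : pzRingType) :=
  {S of GRing.ZmodClosed R S & isTwoSidedMulClosed R S}.

Definition ring_quot (R : pzRingType) (I : twoSidedIdeal R) : Type :=
  Quotient.quot I.

Section RingQuot.
Variables (R : pzRingType) (I : twoSidedIdeal R).

HB.instance Definition _ := GRing.Zmodule.on (ring_quot I).
HB.instance Definition _ :=
  ZmodQuotient.copy (ring_quot I) (Quotient.quot I).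

Definition ring_quot_one : ring_quot I := \pi_(ring_quot I) 1.
Definition ring_quot_mul (x y : ring_quot I) : ring_quot I :=
  \pi_(ring_quot I) (repr x * repr y).

Lemma ring_quot_eq (x y : R) :
  \pi_(ring_quot I) x = \pi_(ring_quot I) y <-> x - y \in I.
Proof.
have -> : x - y \in I = (\pi_(ring_quot I) x == \pi_(ring_quot I) y).
  exact: (Quotient.idealrBE I x y).
by split=> /eqP.
Qed.

Lemma ring_quot_mulE :
  {morph \pi_(ring_quot I) : x y / x * y >-> ring_quot_mul x y}.
Proof.
move=> x y; apply/ring_quot_eq; set x' := repr _; set y' := repr _.
have Ix : x - x' \in I by apply/ring_quot_eq; rewrite reprK.
have Iy : y - y' \in I by apply/ring_quot_eq; rewrite reprK.
rewrite -[x * y](subrK (x' * y)) -addrA -mulrBl -mulrBr.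
rewrite rpredD //; first exact: (@ideal_mulr R I y _ Ix).
exact: (@ideal_mull R I x' _ Iy).
Qed.

Let piM (x y : R) :
  ring_quot_mul (\pi_(ring_quot I) x) (\pi_(ring_quot I) y) =
  \pi_(ring_quot I) (x * y).
Proof. by rewrite ring_quot_mulE. Qed.

Let piD (x y : R) : \pi_(ring_quot I) x + \pi_(ring_quot I) y =
  \pi_(ring_quot I) (x + y).
Proof. by rewrite pi_addr. Qed.

Lemma ring_quot_mulA : associative ring_quot_mul.
Proof.
elim/quotW=> x; elim/quotW=> y; elim/quotW=> z.
by rewrite (piM x y) (piM y z) !(piM x) (piM (x * y)) mulrA.
Qed.

Lemma ring_quot_mul1l : left_id ring_quot_one ring_quot_mul.
Proof. by elim/quotW=> x; rewrite piM mul1r. Qed.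

Lemma ring_quot_mul1r : right_id ring_quot_one ring_quot_mul.
Proof. by elim/quotW=> x; rewrite piM mulr1. Qed.

Lemma ring_quot_mulDl : left_distributive ring_quot_mul +%R.
Proof.
elim/quotW=> x; elim/quotW=> y; elim/quotW=> z.
by rewrite (piD x y) (piM x z) (piM y z) (piM (x + y)) piD mulrDl.
Qed.

Lemma ring_quot_mulDr : right_distributive ring_quot_mul +%R.
Proof.
elim/quotW=> x; elim/quotW=> y; elim/quotW=> z.
by rewrite (piD y z) (piM x y) (piM x z) (piM x) piD mulrDr.
Qed.

HB.instance Definition _ := GRing.Zmodule_isPzRing.Build (ring_quot I)
  ring_quot_mulA ring_quot_mul1l ring_quot_mul1r
  ring_quot_mulDl ring_quot_mulDr.

Lemma ring_quot_pi_monoid_morphism : monoid_morphism \pi_(ring_quot I).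
Proof. by split=> // x y; rewrite ring_quot_mulE. Qed.

End RingQuot.

Section FiniteImage.
Variable A : zmodType.

Definition finite_image_endo (f : endo A) : bool := `[< finite_set (range f) >].

Lemma finite_image_endoP (f : endo A) :
  reflect (finite_set (range f)) (f \in finite_image_endo).
Proof. exact: asboolP. Qed.

Lemma finite_image_endo_zmod_closed : zmod_closed finite_image_endo.
Proof.
split=> [|f g /finite_image_endoP fF /finite_image_endoP gF]; apply/finite_image_endoP.
  by apply: (sub_finite_set _ (finite_set1 (0 : A))) => _ [x _ <-].
apply: (sub_finite_set _ (finite_image2 (fun a b : A => a - b) fF gF)).
by move=> _ [x _ <-]; exists (f x); [exists x|exists (g x); [exists x|]].
Qed.

HB.instance Definition _ :=
  GRing.isZmodClosed.Build (endo A) finite_image_endo finite_image_endo_zmod_closed.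

Lemma finite_image_endo_mull (g f : endo A) :
  f \in finite_image_endo -> g * f \in finite_image_endo.
Proof.
move=> /finite_image_endoP fF; apply/finite_image_endoP.
apply: (sub_finite_set _ (finite_image g fF)).
by move=> _ [x _ <-]; exists (f x) => //; exists x.
Qed.

Lemma finite_image_endo_mulr (g f : endo A) :
  f \in finite_image_endo -> f * g \in finite_image_endo.
Proof.
move=> /finite_image_endoP fF; apply/finite_image_endoP.
by apply: (sub_finite_set _ fF) => _ [x _ <-]; exists (g x).
Qed.

HB.instance Definition _ := isTwoSidedMulClosed.Build (endo A) finite_image_endo
  finite_image_endo_mull finite_image_endo_mulr.

Definition finite_image_ideal : twoSidedIdeal (endo A) :=
  TwoSidedIdeal.clone (endo A) finite_image_endo _.

End FiniteImage.

(* The topology is a parameter, so as to quantify over all the topologies on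
   the fixed carrier Q; the type casts only switch between the algebraic and
   the topological structure of Q. *)
Definition ring_topology (Q : pzRingType) (tau : Topological Q) : Prop :=
  let T : topologicalType := Topological.Pack tau in
  [/\ continuous (fun x : T * T => ((x.1 : Q) + (x.2 : Q) : Q) : T),
      continuous (fun x : T => (- (x : Q) : Q) : T) &
      continuous (fun x : T * T => ((x.1 : Q) * (x.2 : Q) : Q) : T)].

Definition tychonoff (T : topologicalType) : Prop :=
  completely_regular_space T /\ hausdorff_space T.

Definition nondiscrete (T : topologicalType) : Prop :=
  ~ forall U : set T, open U.

Definition admits_nondiscrete_locally_compact_ring_topology
    (Q : pzRingType) : Prop :=
  exists tau : Topological Q,
    let T : topologicalType := Topological.Pack tau in
    [/\ ring_topology tau, tychonoff T, locally_compact [set: T] &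
      nondiscrete T].

(* Main.v *)
Require Import Defs.
From HB Require Import structures.
From mathcomp Require Import all_boot all_order all_algebra all_classical.
From mathcomp Require Import generic_quotient ring_quotient wochoice.
From mathcomp Require Import reals topology normedtype urysohn Rstruct.

Set Implicit Arguments.
Unset Strict Implicit.
Unset Printing Implicit Defensive.

Import Order.TTheory GRing.Theory Num.Theory.
Import numFieldTopology.Exports.

Local Open Scope classical_set_scope.
Local Open Scope ring_scope.
Local Open Scope quotient_scope.

(** Write Q for the quotient R/I. Local compactness and the Continuum
    Hypothesis serve only to produce a countable neighbourhood base; the ring
    structure of Q then rules out every nondiscrete Hausdorff ring topology
    with such a base.

    Countable base ([aleph1_regular_Gdelta_point],
    [regular_Gdelta_point_countable_base]). In a locally compact Hausdorff
    space, a point that is the intersection of countably many of its closed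
    neighbourhoods has a countable base. If a nonempty locally compact
    Tychonoff space of cardinality at most aleph_1 had no such point, then
    every nonempty regular G_delta set could be shrunk so as to miss any
    prescribed point. Enumerate the points along omega_1 and remove them one
    after the other, starting inside a compact set and intersecting at limit
    stages. Every stage has countably many predecessors, so the sets stay
    regular G_delta, and they stay nonempty by compactness. The intersection
    of all of them is nonempty but misses every point. This is the classical
    argument that a compact space without points of countable character has at
    least 2^aleph_1 points, reduced to one branch of the tree by diagonalizing
    against an enumeration. Since Q embeds in the power set of a countable set,
    the Continuum Hypothesis makes it applicable to Q.

    Contradiction ([no_countable_base_of_simultaneous_units],
    [endo_quotient_simultaneous_units]). Choose disjoint infinite parts of a
    basis of A, indexed by k, and let q_k embed A onto the span of the k-th
    part and p_k project onto it and undo q_k. By homogeneity there is a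
    countable base (U_k) at 0; as the topology is not discrete and
    multiplication by constants is continuous, there is a nonzero z_k in Q
    with x_k = q_k z_k p_k in U_k. An endomorphism of infinite image can be
    multiplied on both sides to give 1, so a_k z_k c_k = 1 for suitable a_k
    and c_k. The a_k glue to one a with a q_k = a_k for all k, and, modulo
    endomorphisms of finite image, the c_k glue to one c with p_k c = c_k.
    Hence a x_k c = 1 for every k. But the x such that a x c differs from 1
    form a neighbourhood of 0, which contains some U_n and thus x_n.

    The linear algebra takes place in the model {poly 'F_p} of A, where the
    degrees of the elements of a subgroup replace Gaussian elimination
    ([adapted_basis]). *)

(** * Well-orders and transfinite recursion *)

Section WellOrder.
Variables (W : Type) (Le : rel W).
Hypothesis wo : well_order Le.

Lemma total_of_well_order w v : Le w v \/ Le v w.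
Proof.
have [|z [[]]] := wo (A := [pred x | `[< x = w \/ x = v >]]).
  by exists w; apply/asboolP; left.
move=> /asboolP[->|->] zP _; [left|right]; apply: zP; apply/asboolP.
  by right.
by left.
Qed.

(** Antisymmetry comes from the uniqueness of minima: two elements below each
    other are both minimum of the pair that they form. *)
Lemma antisym_of_well_order w v : Le w v -> Le v w -> w = v.
Proof.
move=> wv vw; have rfl x : Le x x by case: (total_of_well_order x x).
have [|z [_ zP]] := wo (A := [pred x | `[< x = w \/ x = v >]]).
  by exists w; apply/asboolP; left.
have zw : z = w.
  by apply: zP; split=> [|x /asboolP[->|->]//]; apply/asboolP; left.
have zv : z = v.
  by apply: zP; split=> [|x /asboolP[->|->]//]; apply/asboolP; right.
by rewrite -zw zv.
Qed.

Lemma well_founded_of_well_order :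
  well_founded (fun w v => Le w v /\ w <> v).
Proof.
set Lt := fun w v => _.
have [//|noacc] := pselect (well_founded Lt).
have [v nv] : exists v, ~ Acc Lt v by apply/existsNP.
have [|z [[/asboolP nz zP] _]] := wo (A := [pred x | `[< ~ Acc Lt x >]]).
  by exists v; apply/asboolP.
case: nz; split=> y [yz]; apply: contra_notP => nAy.
by apply: antisym_of_well_order yz (zP _ _); apply/asboolP.
Qed.

End WellOrder.

(** The existence of H is isolated from the properties of [step] so that the
    fixpoint stays opaque: afterwards only its equation is used. *)
Lemma wf_bigcap_recursion (W T : Type) (Lt : W -> W -> Prop)
    (step : set T -> W -> set T) : well_founded Lt ->
  exists H : W -> set T,
    forall v, H v = step (\bigcap_(w in [set w | Lt w v]) H w) v.
Proof.
move=> wf; pose F v (rec : forall w, Lt w v -> set T) :=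
  step [set t | forall w (wv : Lt w v), rec w wv t] v.
exists (Fix wf (fun=> set T) F) => v; rewrite Fix_eq //.
by move=> x f g fg; congr step; apply/seteqP;
  split=> t tP w wx; move: (tP w wx); rewrite fg.
Qed.

(** * Points with a countable neighbourhood base *)

Section RegularGdelta.
Variable T : topologicalType.
Implicit Types (F G K : set T) (CC : set (set T)).

(** Unlike for arbitrary closed G_delta sets, the witnesses here are closed
    neighbourhoods, so that for a one-point set they are the candidates for a
    neighbourhood base. *)
Definition regular_Gdelta F := exists CC : set (set T),
  [/\ countable CC, forall C, CC C -> closed C /\ F `<=` C° &
      F = \bigcap_(C in CC) C].

Lemma regular_Gdelta_closed F : regular_Gdelta F -> closed F.
Proof. by case=> CC [_ clC ->]; apply: closed_bigI => C /clC[]. Qed.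

Lemma regular_Gdelta_bigcap I (D : set I) (F : I -> set T) : countable D ->
  (forall i, D i -> regular_Gdelta (F i)) ->
  regular_Gdelta (\bigcap_(i in D) F i).
Proof.
move=> cD rF; have /choice[CC CCP] : forall i, exists CC : set (set T), D i ->
    [/\ countable CC, forall C, CC C -> closed C /\ F i `<=` C° &
      F i = \bigcap_(C in CC) C].
  move=> i; have [/rF[CC CCP]|nDi] := pselect (D i); first by exists CC.
  by exists set0.
exists (\bigcup_(i in D) CC i); split.
- by apply: bigcup_countable => // i /CCP[].
- move=> C [i Di CiC]; have [_ /(_ _ CiC)[clC FC] _] := CCP _ Di; split=> //.
  by move=> x /(_ i Di)/FC.
- apply/seteqP; split=> [x Fx C [i Di CiC]|x Cx i Di].
    by have [_ _ FE] := CCP _ Di; have := Fx i Di; rewrite FE; apply.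
  by have [_ _ ->] := CCP _ Di => C CiC; apply: Cx; exists i.
Qed.

Lemma regular_GdeltaI F G :
  regular_Gdelta F -> regular_Gdelta G -> regular_Gdelta (F `&` G).
Proof.
move=> rF rG; rewrite -bigcap2E; apply: regular_Gdelta_bigcap => //.
by case=> [|[|]] //= n _; exists set0; split=> //; rewrite bigcap_set0.
Qed.

(** The zero set of a continuous function f >= 0 is the intersection of the
    closed neighbourhoods f <= 1/(n+1). The parameter [R] is any model of the
    reals in which f may take its values. *)
Lemma regular_Gdelta_separation (R : realType) : completely_regular_space T ->
  forall x B, closed B -> ~ B x ->
  exists G, [/\ regular_Gdelta G, G x & forall y, G y -> ~ B y].
Proof.
move=> crT x B clB nBx.
have /(@uniform_separatorP _ R)[f [cf _ fx fB]] := crT _ _ clB nBx.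
have {}fx : f x = 0 by apply: fx; exists x.
exists [set y | f y <= 0]; split; last 2 first.
- by rewrite /= fx.
- move=> y /= fy By; have : f y = 1 by apply: fB; exists y.
  by move=> fy1; rewrite fy1 ler10 in fy.
exists (range (fun n => [set y | f y <= n.+1%:R^-1])); split.
- exact: card_image_le.
- move=> _ [n _ <-]; split.
    exact: (iffLR (continuous_closedP _) cf _ (@closed_le R n.+1%:R^-1)).
  suff opf : open [set y | f y < n.+1%:R^-1].
    move=> y /= fy; apply: filterS (open_nbhs_nbhs (conj opf _)) => /=.
      by move=> z /ltW.
    by rewrite (le_lt_trans fy)// invr_gt0.
  exact: (iffLR (continuousP _) cf _ (@open_lt R n.+1%:R^-1)).
- apply/seteqP; split=> y /= => [fy _ [n _ <-] /=|yC].
    by rewrite (le_trans fy)// invr_ge0.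
  rewrite leNgt; apply/negP => /ltr_add_invr[n]; rewrite add0r.
  rewrite ltNge; apply/negP; rewrite negbK.
  by apply: (yC [set z | f z <= n.+1%:R^-1]); exists n.
Qed.

(** Intersecting with [K] makes the statement cover the empty chain as well,
    that is, the first stage of the recursion below. *)
Lemma chain_bigcap_compact (K : set T) I (D : set I) (F : I -> set T) :
  compact K -> K !=set0 ->
  (forall i, D i -> [/\ closed (F i), F i !=set0 & F i `<=` K]) ->
  (forall i j, D i -> D j -> F i `<=` F j \/ F j `<=` F i) ->
  (K `&` \bigcap_(i in D) F i) !=set0.
Proof.
move=> cK K0 FP chainF; have [D0|/set0P[i0 Di0]] := eqVneq D set0.
  by rewrite D0 bigcap_set0 setIT.
have FF : ProperFilter (filter_from D F).
  apply: filter_from_proper => [|i /FP[]//].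
  apply: filter_from_filter; first by exists i0.
  by move=> i j Di Dj; have [FS|FS] := chainF _ _ Di Dj; [exists i|exists j];
    rewrite // subsetI; split.
have [|x [Kx clx]] := cK _ FF; first by exists i0 => //; have [] := FP _ Di0.
exists x; split=> // i Di; have [clF _ _] := FP _ Di; apply: clF.
by rewrite clusterE in clx; apply: clx; exists i.
Qed.

Lemma locally_compact_nbhs (x : T) : locally_compact [set: T] ->
  exists2 K, nbhs x K & compact K.
Proof. by move=> /(_ x I)[K]; rewrite withinET => xK [cK _]; exists K. Qed.

(** The finite intersections of the closed neighbourhoods, cut down to a
    compact neighbourhood, generate a filter whose only cluster point is x; by
    compactness this filter converges to x, so its generators form a base. *)
Lemma regular_Gdelta_point_countable_base (x : T) :
  hausdorff_space T -> locally_compact [set: T] -> regular_Gdelta [set x] ->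
  exists U : nat -> set T, (forall n, nbhs x (U n)) /\
    forall B, nbhs x B -> exists n, U n `<=` B.
Proof.
move=> hT /(locally_compact_nbhs x)[K xK cK] [CC [cCC CCP xE]].
have /countable_injP[e e_inj] := cCC.
pose C n := \bigcap_(D in [set D | CC D /\ e D = n]) D.
(* [C] enumerates CC along the injection [e]; off the image of [e] it is the
   empty intersection, the whole space. *)
have xC n : nbhs x (C n).
  have [[D [CCD eD]]|nD] := pselect (exists D, CC D /\ e D = n).
    have [_ xD] := CCP _ CCD; apply: filterS (xD x erefl) => z Dz E [CCE eE].
    by rewrite (_ : E = D)//; apply: e_inj; rewrite ?inE// eE.
  by apply: filterS (filterT : nbhs x setT) => z _ D DP; case: nD; exists D.
pose U n := K `&` \bigcap_(i in `I_n) C i.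
have xU n : nbhs x (U n).
  apply: filterI => //; elim: n => [|n IH].
    by rewrite II0 bigcap_set0; exact: filterT.
  by rewrite IIS bigcap_setU bigcap_set1; apply: filterI.
have UF : ProperFilter (filter_from setT U).
  apply: filter_from_proper => [|n _]; last by exists x; exact: nbhs_singleton.
  apply: filter_fromT_filter; first by exists 0%N.
  move=> m n; exists (maxn m n); rewrite subsetI; split; apply: setIS;
    move=> z zC i /= im; apply: zC => /=; apply: leq_trans im _.
    exact: leq_maxl.
  exact: leq_maxr.
exists U; split=> // B xB.
have : filter_from setT U --> x.
  apply: (compact_cluster_set1 hT cK xK UF).
    by exists 0%N => //; rewrite /U II0 bigcap_set0 setIT.
  rewrite clusterE; apply/seteqP; split=> [y yU|_ -> V [n _ UV]].
    rewrite xE => D CCD; have [clD _] := CCP D CCD; apply: clD; apply: yU.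
    by exists (e D).+1 => // z [_ /(_ (e D))]; apply => /=.
  by apply: subset_closure; apply: UV; exact: nbhs_singleton.
by move=> /(_ B xB)[n _ UB]; exists n.
Qed.

(** The diagonal argument: the stages H v, for v running through a well-order
    of type omega_1, decrease, and H v avoids the point s v. *)
Lemma aleph1_regular_Gdelta_point (R : realType) (W : Type) (s : W -> T) (x0 : T) :
  has_card_aleph1 W -> (forall x, exists w, s w = x) ->
  completely_regular_space T -> hausdorff_space T ->
  locally_compact [set: T] ->
  exists x : T, regular_Gdelta [set x].
Proof.
move=> [Le [wo _ cLe]] s_surj crT hT lcT.
apply: contrapT => noG.
have [K x0K cK] := locally_compact_nbhs x0 lcT.
have [F0 [rF0 F0x0 F0K]] : exists F, [/\ regular_Gdelta F, F x0 & F `<=` K].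
  have [||G [rG Gx0 GK]] := @regular_Gdelta_separation R crT x0 (~` K°).
  - exact/open_closedC/open_interior.
  - by apply; exact: x0K.
  - exists G; split=> // y /GK nKy; apply: interior_subset.
    by apply: contrapT.
have cF0 : compact F0.
  exact: subclosed_compact (regular_Gdelta_closed rF0) cK F0K.
(* By [noG] a nonempty regular G_delta set is not a single point, so it
   contains some y other than x, which can be separated from x. *)
have shrink F x : exists G, regular_Gdelta F -> F !=set0 ->
    [/\ regular_Gdelta G, G !=set0, G `<=` F & ~ G x].
  have [[rF [z Fz]]|nF] := pselect (regular_Gdelta F /\ F !=set0); last first.
    by exists set0 => rF F0'; case: nF.
  have [y [Fy yx]] : exists y, F y /\ y != x.
    apply: contrapT => nF; apply: noG; exists x.
    have FS y : F y -> y = x.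
      by move=> Fy; apply/eqP/negP => /negP yx; apply: nF; exists y.
    rewrite (_ : [set x] = F)//; apply/seteqP; split=> [_ ->|y /FS//].
    by rewrite -(FS z Fz).
  have [||G [rG Gy Gx]] := @regular_Gdelta_separation R crT y [set x].
  - exact/accessible_closed_set1/hausdorff_accessible.
  - by move=> /= /eqP; apply/negP.
  - exists (F `&` G) => _ _; split; first exact: regular_GdeltaI.
    + by exists y.
    + by move=> ? [].
    + by move=> [_ /Gx]; apply.
have /choice[sh shP] := fun Fx => shrink Fx.1 Fx.2.
pose Lt w v := Le w v /\ w <> v.
have LeT w v : Le w v \/ Le v w := total_of_well_order wo w v.
have wfLt : well_founded Lt := well_founded_of_well_order wo.
have [H HE] := wf_bigcap_recursion (fun F v => sh (F0 `&` F, s v)) wfLt.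
have HP v : [/\ regular_Gdelta (H v), H v !=set0, H v `<=` F0, ~ H v (s v) &
    forall w, Lt w v -> H v `<=` H w].
  elim/(well_founded_ind wfLt): v => v IH.
  have [rFv Fv0] : regular_Gdelta (F0 `&` \bigcap_(w in [set w | Lt w v]) H w) /\
      (F0 `&` \bigcap_(w in [set w | Lt w v]) H w) !=set0.
    split.
      apply: regular_GdeltaI => //; apply: regular_Gdelta_bigcap.
        by apply: sub_countable (cLe v); apply: subset_card_le => w [].
      by move=> w /IH[].
    apply: chain_bigcap_compact => //; first by exists x0.
      by move=> w /IH[/regular_Gdelta_closed ? ? ? _ _]; split.
    move=> w u wv uv; have [->|wu] := pselect (w = u); first by left.
    have [/IH[_ _ _ _ Hw] /IH[_ _ _ _ Hu]] := (wv, uv).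
    have [le|le] := LeT w u; [right; apply: Hu|left; apply: Hw]; split=> //.
    exact: nesym.
  have := shP (F0 `&` \bigcap_(w in [set w | Lt w v]) H w, s v) rFv Fv0.
  rewrite -HE => -[rH H0 HS nHs]; split=> //.
    by move=> t /HS[].
  by move=> w wv t /HS[_ /(_ w wv)].
have [||w u _ _|x [_ xH]] := chain_bigcap_compact (D := setT) (F := H) cF0.
- by exists x0.
- by move=> w _; have [/regular_Gdelta_closed ? ? ? _ _] := HP w; split.
- have [->|wu] := pselect (w = u); first by left.
  have [[_ _ _ _ Hw] [_ _ _ _ Hu]] := (HP w, HP u).
  have [le|le] := LeT w u; [right; apply: Hu|left; apply: Hw]; split=> //.
  exact: nesym.
have [w wx] := s_surj x.
by have [_ _ _ + _] := HP w; apply; rewrite wx; apply: xH.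
Qed.

End RegularGdelta.

(** * Ring topologies with a countable base *)

(** Infinitely many nonzero elements, once moved to suitable independent
    corners q_k Q p_k, become 1 under one and the same two-sided
    multiplication. It is this uniformity in k that no sequence tending to 0
    can tolerate. *)
Definition simultaneous_units (Q : pzRingType) := exists p q : nat -> Q,
  forall z : nat -> Q, (forall k, z k <> 0) ->
  exists a b, forall k, a * (q k * z k * p k) * b = 1.

Section RingTopology.
Variables (Q : pzRingType) (tau : Topological Q).
Let T : topologicalType := Topological.Pack tau.
Hypothesis ringT : ring_topology tau.

Let continuous_comp2 (f : T * T -> T) (g h : T -> T) :
  continuous f -> continuous g -> continuous h ->
  continuous (fun t => f (g t, h t)).
Proof.
move=> cf cg ch t; apply: (@continuous_comp _ _ _ (fun t => (g t, h t)) f).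
  by apply: cvg_pair; [exact: cg|exact: ch].
exact: cf.
Qed.

Let nbhs_affine (a b c d y : Q) (B : set Q) :
  nbhs (a * (y + c) * b + d : T) (B : set T) ->
  nbhs (y : T) [set t : T | B (a * ((t : Q) + c) * b + d)].
Proof.
have [cD _ cM] := ringT.
have cC (e : T) : continuous (fun _ : T => e) by move=> t; exact: cvg_cst.
have cI : continuous (fun t : T => t) by move=> t; exact: cvg_id.
have c1 := continuous_comp2 cD cI (cC c).
have c2 := continuous_comp2 cM (cC a) c1.
have c3 := continuous_comp2 cM c2 (cC b).
have c4 := continuous_comp2 cD c3 (cC d).
by move=> yB; exact: (c4 y B yB).
Qed.

Lemma discrete_of_nbhs0 : nbhs (0 : T) [set (0 : T)] -> forall V : set T, open V.
Proof.
move=> n0 V; rewrite openE => y Vy; rewrite /interior /=.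
have := @nbhs_affine 1 1 (- (y : Q)) 0 y [set 0].
rewrite subrr mulr0 mul0r addr0 => /(_ n0).
apply: filterS => t /=; rewrite mul1r mulr1 addr0 => /(canRL (subrK _)).
by rewrite add0r => ->.
Qed.

(** The base is allowed to sit at any point x: in place of translating it to 0,
    the sequence is chosen as x + q_k z_k p_k. *)
Lemma no_countable_base_of_simultaneous_units (x : T) (U : nat -> set T) :
  1 <> 0 :> Q -> simultaneous_units Q ->
  hausdorff_space T -> nondiscrete T ->
  (forall n, nbhs x (U n)) ->
  ~ (forall B, nbhs x B -> exists n, U n `<=` B).
Proof.
move=> nz10 [p [q pq]] hT ndT xU Ubase.
have /choice[z zP] : forall k, exists z : Q, z <> 0 /\ U k (q k * z * p k + (x : Q)).
  move=> k; apply: contrapT => nz; apply/ndT/discrete_of_nbhs0.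
  have := @nbhs_affine (q k) (p k) 0 x 0 (U k).
  rewrite addr0 mulr0 mul0r add0r => /(_ (xU k)).
  apply: filterS => t /=; rewrite addr0 => Ut; apply: contrapT => t0.
  by apply: nz; exists t.
have [|a [b ab]] := pq z; first by move=> k; have [] := zP k.
have nb0 : nbhs (0 : T) (~` [set (1 : T)]).
  apply: open_nbhs_nbhs; split; last by move=> /= /esym.
  exact/closed_openC/accessible_closed_set1/hausdorff_accessible.
have := @nbhs_affine a b (- (x : Q)) 0 x (~` [set 1]).
rewrite subrr mulr0 mul0r addr0 => /(_ nb0) /Ubase[n Un].
have [_ /Un /=] := zP n; apply; by rewrite addrK addr0 ab.
Qed.

End RingTopology.

(** * Additive maps on polynomials over a prime field *)

Lemma exists_additive (U V : zmodType) (f : U -> V) :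
  zmod_morphism f -> exists g : {additive U -> V}, g =1 f.
Proof.
move=> fB; pose g := GRing.isZmodMorphism.Build U V f fB.
by pose h : {additive U -> V} := HB.pack f g; exists h.
Qed.

Lemma additive_inverse (U V : zmodType) (f : {additive U -> V}) :
  bijective f -> exists g : {additive V -> U}, cancel f g /\ cancel g f.
Proof.
case=> g fK gK; have [h hg] := exists_additive (can2_zmod_morphism fK gK).
by exists h; split=> x; rewrite hg.
Qed.

Lemma infinite_of_card_nat (T : Type) :
  ([set: T] #= [set: nat])%card -> infinite_set [set: T].
Proof. by move=> cardT; rewrite (eq_finite_set cardT); exact: infinite_nat. Qed.

Lemma finite_set_nat_bound (D : set nat) : finite_set D ->
  exists m, forall i, D i -> (i < m)%N.
Proof.
move=> /finite_seqP[X ->]; exists (\max_(i <- X) i).+1 => i /= iX.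
by rewrite ltnS (@leq_bigmax_seq _ _ xpredT id).
Qed.

Lemma infinite_set_nat_enum (D : set nat) : infinite_set D ->
  exists j j' : nat -> nat,
    [/\ forall n, D (j n), cancel j j' & forall i, D i -> j (j' i) = i].
Proof.
move=> Dinf; have := eq_card_nat (countableP D) Dinf.
rewrite card_eq_sym => /card_set_bijP[j [jD j_inj j_surj]].
have /choice[j' j'P] : forall i, exists n, D i -> j n = i.
  move=> i; have [/j_surj[n _ <-]|nDi] := pselect (D i); first by exists n.
  by exists 0%N.
have jD' n : D (j n) by apply: jD.
by exists j, j'; split=> // n; apply: j_inj; rewrite ?inE// j'P.
Qed.

Section Polynomials.
Variables (p : nat) (p_pr : prime p).
Local Notation F := 'F_p.
Implicit Types (P Q : {poly F}) (V : zmodType).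

Lemma Fp_scale (V : lmodType F) (c : F) (v : V) : c *: v = v *+ (c : nat).
Proof. by rewrite -scaler_nat natr_Zp. Qed.

Lemma additive_polyE V (h : {additive {poly F} -> V}) n P : (size P <= n)%N ->
  h P = \sum_(i < n) h 'X^i *+ (P`_i)%R.
Proof.
move=> szP; rewrite -[P in LHS]coefK poly_def raddf_sum.
rewrite (big_ord_widen n (fun i => h (P`_i *: 'X^i)) szP) big_mkcond /=.
apply: eq_bigr => i _; rewrite Fp_scale raddfMn.
by case: ltnP => // /leq_sizeP->.
Qed.

Lemma eq_additive_poly V (h k : {additive {poly F} -> V}) :
  (forall i, h 'X^i = k 'X^i) -> h =1 k.
Proof.
move=> hk P; rewrite !(additive_polyE _ (leqnn (size P))).
by apply: eq_bigr => i _; rewrite hk.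
Qed.

(** The coefficients act through their representatives in nat, which is
    compatible with addition because p annihilates V. *)
Lemma extend_additive_poly V (g : nat -> V) : elementary_abelian p V ->
  exists h : {additive {poly F} -> V}, forall i, h 'X^i = g i.
Proof.
move=> pV.
have modp (v : V) n : v *+ (n %% p) = v *+ n.
  by rewrite [in RHS](divn_eq n p) mulrnDr mulnC mulrnA pV mul0rn add0r.
have Fp_mulrnB (v : V) (c d : F) : v *+ (c - d)%R = v *+ c - v *+ d.
  apply/eqP; rewrite eq_sym subr_eq -mulrnDr; apply/eqP; rewrite -[RHS]modp.
  have -> : v *+ c = v *+ (c - d + d)%R by rewrite subrK.
  move: (c - d)%R => e; congr (v *+ _); rewrite /=.
  by move: (nat_of_ord e) (nat_of_ord d) => m n; rewrite Fp_cast.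
pose f P := \sum_(i < size P) g i *+ (P`_i)%R.
have fE n P : (size P <= n)%N -> f P = \sum_(i < n) g i *+ (P`_i)%R.
  move=> szP; rewrite /f (big_ord_widen n (fun i => g i *+ (P`_i)%R) szP).
  rewrite big_mkcond; apply: eq_bigr => i _; case: ltnP => // /leq_sizeP->//.
have [|h hE] := @exists_additive _ _ f.
  move=> P Q; pose n := maxn (size P) (size Q).
  rewrite !(fE n) ?leq_maxl ?leq_maxr //; last first.
    by rewrite (leq_trans (size_polyD _ _))// size_polyN.
  by rewrite -sumrB; apply: eq_bigr => i _; rewrite coefB Fp_mulrnB.
exists h => i; rewrite hE (fE i.+1) ?size_polyXn // big_ord_recr /=.
rewrite coefXn eqxx big1 ?add0r => [|j _]; last first.
  by rewrite coefXn ltn_eqF // mulr0n.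
by rewrite /= /Zp_trunc /=.
Qed.

Lemma additive_polyZ (h : {additive {poly F} -> {poly F}}) c P :
  h (c *: P) = c *: h P.
Proof. by rewrite !Fp_scale raddfMn. Qed.

Lemma elementary_abelian_poly : elementary_abelian p {poly F}.
Proof. by move=> P; rewrite -mulr_natr -polyC_natr pchar_Fp_0 // mulr0. Qed.

Lemma finite_poly_size_le n : finite_set [set P : {poly F} | (size P <= n)%N].
Proof.
apply: (@sub_finite_set _ _ (range (@rVpoly F n))).
  by move=> P szP; exists (poly_rV P) => //; rewrite poly_rV_K.
exact: (finite_image _ (@finite_finset _ [set: 'rV_n])).
Qed.

Section Triangular.
Variable t : {additive {poly F} -> {poly F}}.
Hypothesis size_t : forall i, size (t 'X^i) = i.+1.

(** The image of the leading monomial cannot be cancelled, as the images of the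
    others have smaller degree. *)
Lemma size_triangular P : size (t P) = size P.
Proof.
case E: (size P) => [|n].
  by move/eqP: E; rewrite size_poly_eq0 => /eqP ->; rewrite raddf0 size_poly0.
have Pn0 : P`_n != 0 by rewrite -[n]/(n.+1.-1) -E lead_coef_eq0 -size_poly_eq0 E.
rewrite (additive_polyE _ (leqnn (size P))) E big_ord_recr /= addrC.
have sz : size (t 'X^n *+ (P`_n)%R) = n.+1 by rewrite -Fp_scale size_scale // size_t.
rewrite size_polyDl sz // ltnS.
apply/(leq_trans (size_sum _ _ _))/bigmax_leqP => i _.
by rewrite -Fp_scale (leq_trans (size_scale_leq _ _))// size_t.
Qed.

Lemma bij_triangular : bijective t.
Proof.
have t_inj : injective t.
  apply: raddf_inj => P tP0; apply/eqP; rewrite -size_poly_eq0.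
  by rewrite -size_triangular tP0 size_poly0.
have t_surj n Q : (size Q <= n)%N -> exists P, t P = Q.
  elim: n => [|n IH] in Q *.
    rewrite leqn0 size_poly_eq0 => /eqP->; exists 0; exact: raddf0.
  move=> szQ; pose c := Q`_n / (t 'X^n)`_n.
  have [|P tP] := IH (Q - t (c *: 'X^n)).
    have szD : (size (Q - t (c *: 'X^n))%R <= n.+1)%N.
      rewrite (leq_trans (size_polyD _ _))// size_polyN geq_max szQ /=.
      by rewrite additive_polyZ (leq_trans (size_scale_leq _ _))// size_t.
    apply/leq_sizeP => j; rewrite leq_eqVlt => /orP[/eqP<-|]; last first.
      by move: szD => /leq_sizeP; apply.
    rewrite coefB additive_polyZ coefZ divfK ?subrr//.
    have : lead_coef (t 'X^n) != 0 by rewrite lead_coef_eq0 -size_poly_eq0 size_t.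
    by rewrite lead_coefE size_t.
  by exists (P + c *: 'X^n); rewrite raddfD tP subrK.
have /choice[t' t'K] : forall Q, exists P, t P = Q.
  by move=> Q; exact: (t_surj _ _ (leqnn _)).
by exists t' => // P; apply: t_inj.
Qed.

End Triangular.

(** D is the set of degrees of elements of N. Choosing one element of N for
    each degree in D, and a monomial for every other degree, gives a triangular
    basis of the whole space. An element of N has no component outside D,
    because the top degree of such a component would belong to D. So, up to the
    automorphism t, the subgroup N and a complement of it are spanned by
    monomials: this applies to kernels and to images of additive maps. *)
Lemma adapted_basis (N : set {poly F}) :
  N 0 -> (forall P Q, N P -> N Q -> N (P - Q)) ->
  exists (D : set nat) (t : {additive {poly F} -> {poly F}}),
    bijective t /\ forall P, N (t P) <-> forall i, ~ D i -> P`_i = 0.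
Proof.
move=> N0 NB; have ND P Q : N P -> N Q -> N (P + Q).
  by move=> NP NQ; rewrite -[Q]opprK -[- Q]add0r; apply/NB/NB.
have NM P n : N P -> N (P *+ n).
  by move=> NP; elim: n => // n IH; rewrite mulrS; apply: ND.
pose D := [set d | exists P, N P /\ size P = d.+1].
have /choice[u uP] : forall i, exists U : {poly F}, size U = i.+1 /\ (D i -> N U).
  move=> i; have [[U [NU szU]]|nDi] := pselect (D i); first by exists U.
  by exists 'X^i; rewrite size_polyXn; split.
have [|t tX] := @extend_additive_poly {poly F} u.
  exact: elementary_abelian_poly.
have szt i : size (t 'X^i) = i.+1 by rewrite tX; have [] := uP i.
have NI P : (forall i, ~ D i -> P`_i = 0) -> N (t P).
  move=> PD; rewrite (additive_polyE _ (leqnn _)).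
  apply: big_ind => // i _; have [Di|nDi] := pselect (D i).
    by apply: NM; rewrite tX; apply: (uP i).2.
  by rewrite PD // mulr0n.
exists D, t; split; first exact: bij_triangular.
move=> P; split=> [NtP|]; last exact: NI.
(* The component of P outside D. *)
pose PJ := \poly_(i < size P) (if `[< D i >] then 0 else P`_i).
have PJE i : PJ`_i = if `[< D i >] then 0 else P`_i.
  rewrite coef_poly; case: ltnP => // /leq_sizeP /(_ _ (leqnn _))->.
  by case: ifP.
have NPJ : N (t PJ).
  rewrite -[PJ](subKr P) raddfB; apply: NB => //; apply: NI => i nDi.
  by rewrite coefB PJE; case: asboolP => // _; rewrite subrr.
have PJ0 : PJ = 0.
  apply/eqP; rewrite -size_poly_eq0; case E: (size PJ) => [//|d].
  have Dd : D d by exists (t PJ); rewrite size_triangular.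
  have : lead_coef PJ == 0 by rewrite lead_coefE E /= PJE; case: asboolP.
  by rewrite lead_coef_eq0 -size_poly_eq0 E.
by move=> i nDi; have := PJE i; rewrite PJ0 coef0; case: asboolP.
Qed.

Section Space.
Variables (A : zmodType) (pA : elementary_abelian p A).
Hypothesis cardA : ([set: A] #= [set: nat])%card.

(** An enumeration e of A gives a surjection ppi from polynomials, 'X^n being
    sent to e n. A monomial complement of its kernel, in an adapted basis, is
    mapped isomorphically to A; it is infinite-dimensional because A is
    infinite. *)
Lemma elementary_abelian_poly_iso :
  exists phi : {additive {poly F} -> A}, bijective phi.
Proof.
have /card_set_bijP[e'] := cardA; rewrite setTT_bijective => -[e e'K eK].
have e_surj a : exists n, e n = a by exists (e' a).
have [ppi ppiX] := extend_additive_poly e pA.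
have [|P Q /= N0 N1|D [t [t_bij tD]]] := @adapted_basis [set P | ppi P = 0].
- exact: raddf0.
- by rewrite raddfB N0 N1 subrr.
have [t' tK t'K] := t_bij.
have Jinf : infinite_set (~` D).
  move=> /finite_set_nat_bound[m Dm]; apply: (infinite_of_card_nat cardA).
  apply: (sub_finite_set _ (finite_image (ppi \o t) (finite_poly_size_le m))).
  move=> a _; have [n <-] := e_surj a; set P := t' 'X^n.
  pose PD := P - take_poly m P; exists (take_poly m P); first exact: size_take_poly.
  have : ppi (t PD) = 0.
    apply/tD => k nDk; have km : (k < m)%N by apply: Dm.
    by rewrite coefB coef_take_poly km subrr.
  by rewrite /PD raddfB raddfB /= t'K ppiX => /eqP; rewrite subr_eq0 => /eqP.
have [j [j' [jJ jK j'K]]] := infinite_set_nat_enum Jinf.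
(* [L] embeds onto the monomial complement and [M] projects back from it. *)
have [phi phiX] := extend_additive_poly (fun n => ppi (t 'X^(j n))) pA.
have [M MX] := extend_additive_poly
  (fun i => if `[< D i >] then 0 else 'X^(j' i)) elementary_abelian_poly.
have [L LX] := extend_additive_poly (fun n => 'X^(j n)) elementary_abelian_poly.
have ML : M \o L =1 idfun.
  apply: eq_additive_poly => n /=.
  by rewrite LX MX jK; case: asboolP => // /jJ.
have phiL : phi =1 ppi \o t \o L by apply: eq_additive_poly => n /=; rewrite LX phiX.
have phiM : phi \o M =1 ppi \o t.
  apply: eq_additive_poly => i /=; rewrite MX; case: asboolP => [Di|nDi].
    rewrite raddf0; symmetry; apply/tD => k nDk; rewrite coefXn.
    by case: eqP => // ki; case: nDk; rewrite ki.
  by rewrite phiX j'K.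
exists phi.
have phi_inj : injective phi.
  apply: raddf_inj => P; rewrite phiL => /tD PD.
  rewrite -[P]ML /= (additive_polyE _ (leqnn _)) big1 // => i _.
  rewrite MX; case: asboolP => [|nDi]; first by rewrite mul0rn.
  by rewrite PD // mulr0n.
have /choice[psi psiK] : forall a, exists P, phi P = a.
  move=> a; have [n <-] := e_surj a.
  by exists (M (t' 'X^n)); have /= -> := phiM (t' 'X^n); rewrite t'K ppiX.
by exists psi => // P; apply: phi_inj.
Qed.

Variable phi : {additive {poly F} -> A}.
Hypothesis phi_bij : bijective phi.
Let b n := phi 'X^n.

Lemma eq_endo_basis (f g : endo A) : (forall n, f (b n) = g (b n)) -> f = g.
Proof.
move=> fg; apply: endoP => x; have [psi phiK psiK] := phi_bij.
by rewrite -[x]psiK; apply: (@eq_additive_poly _ (f \o phi) (g \o phi)).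
Qed.

Lemma endo_of_basis (g : nat -> A) : exists f : endo A, forall n, f (b n) = g n.
Proof.
have [psi [phiK psiK]] := additive_inverse phi_bij.
have [h hX] := extend_additive_poly g pA.
by exists (h \o psi : {additive A -> A}) => n /=; rewrite phiK.
Qed.

(** The image is already reached from the span of the first k basis vectors,
    which is finite. *)
Lemma finite_image_endo_basis (f : endo A) k :
  (forall n, (k <= n)%N -> f (b n) = 0) -> f \in @finite_image_endo A.
Proof.
move=> f0; apply/finite_image_endoP; have [psi phiK psiK] := phi_bij.
apply: (sub_finite_set _ (finite_image (f \o phi) (finite_poly_size_le k))).
move=> _ [x _ <-]; rewrite -[x]psiK; set P := psi x.
exists (take_poly k P); first exact: size_take_poly.
rewrite /= -[in RHS](poly_take_drop k P) !raddfD.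
have -> : f (phi (drop_poly k P * 'X^k)) = 0; last by rewrite addr0.
pose h : {additive {poly F} -> A} := f \o phi.
rewrite -[LHS]/(h _) (additive_polyE _ (leqnn _)) big1 // => i _ /=.
rewrite coefMXn; case: ltnP => [|ki]; first by rewrite mulr0n.
by rewrite f0 // mul0rn.
Qed.

(** In a basis adapted to the image of x, infinitely many basis vectors
    t 'X^(d n) lie in the image. The map c sends the n-th basis vector to a
    preimage of t 'X^(d n), and a sends t 'X^(d n) back to the n-th basis
    vector. *)
Lemma endo_one_of_infinite_image (x : endo A) : x \notin @finite_image_endo A ->
  exists a c : endo A, a * x * c = 1.
Proof.
move=> xinf; have [psi [phiK psiK]] := additive_inverse phi_bij.
pose y : {additive {poly F} -> {poly F}} := psi \o x \o phi.
have [|_ _ [P _ <-] [Q _ <-]|D [t [t_bij tD]]] := @adapted_basis (range y).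
- by exists 0 => //; exact: raddf0.
- by exists (P - Q) => //; exact: raddfB.
have [t' [tK t'K]] := additive_inverse t_bij.
have Dinf : infinite_set D.
  move=> /finite_set_nat_bound[m Dm]; move: xinf; apply/negP; rewrite negbK.
  apply/finite_image_endoP.
  apply: (sub_finite_set _ (finite_image (phi \o t) (finite_poly_size_le m))).
  move=> _ [a _ <-]; exists (t' (psi (x a))); last by rewrite /= t'K psiK.
  have /tD PD : range y (t (t' (psi (x a)))).
    by rewrite t'K; exists (psi a) => //=; rewrite psiK.
  apply/leq_sizeP => i mi; apply: PD => /Dm; by rewrite ltnNge mi.
have [d [d' [dD dK _]]] := infinite_set_nat_enum Dinf.
have /choice[v vE] : forall n, exists P, y P = t 'X^(d n).
  move=> n; suff [P _ yP] : range y (t 'X^(d n)) by exists P.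
  by apply/tD => i nDi; rewrite coefXn; case: eqP => // idn; case: nDi; rewrite idn.
have [a aX] := extend_additive_poly (fun i => 'X^(d' i)) elementary_abelian_poly.
have [c cX] := extend_additive_poly v elementary_abelian_poly.
exists (phi \o a \o t' \o psi : {additive A -> A}), (phi \o c \o psi : {additive A -> A}).
apply: eq_endo_basis => n /=.
change (phi (a (t' (y (c (psi (phi 'X^n)))))) = phi 'X^n).
by rewrite phiK cX vE tK aX dK.
Qed.

(** The basis vectors b (pickle (k, n)) with k fixed form the k-th of the
    disjoint infinite parts. *)
Lemma endo_quotient_simultaneous_units :
  simultaneous_units (ring_quot (finite_image_ideal A)).
Proof.
pose I := finite_image_ideal A.
have /choice[q qb] : forall k : nat, exists f : endo A,
    forall n : nat, f (b n) = b (pickle (k, n)).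
  by move=> k; exact: (endo_of_basis (fun n => b (pickle (k, n)))).
have [r rb] : exists r : nat -> endo A, forall k j n : nat,
    r k (b (pickle (j, n))) = if j == k then b n else 0.
  have /choice[r rb] : forall k : nat, exists f : endo A, forall m, f (b m) =
      if unpickle m is Some (j, n) then if (j : nat) == k then b n else 0 else 0.
    by move=> k; exact: endo_of_basis.
  by exists r => k j n; rewrite rb pickleK.
pose pi (x : endo A) : ring_quot I := \pi_(ring_quot I) x.
exists (fun k => pi (r k)), (fun k => pi (q k)) => z z0.
have /choice[ac acP] : forall k, exists ac : endo A * endo A,
    ac.1 * repr (z k) * ac.2 = 1.
  move=> k; have [|a [c ac]] := @endo_one_of_infinite_image (repr (z k)).
    apply/negP => zI; apply: (z0 k); rewrite -[z k]reprK.
    transitivity (pi 0); last exact: pi_zeror.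
    by apply/ring_quot_eq; rewrite subr0.
  by exists (a, c).
have [a ab] := endo_of_basis (fun m =>
  if unpickle m is Some (k, n) then (ac k).1 (b n) else 0).
have aq k : a * q k = (ac k).1.
  by apply: eq_endo_basis => n; rewrite /= qb ab pickleK.
(* The value at [b n] ought to be the sum over all k, which is infinite.
   Cutting it at k <= n changes each composite [r k * c] on finitely many
   basis vectors only, hence by an endomorphism of finite image. *)
have [c cb] := endo_of_basis (fun n => \sum_(k < n.+1) q k ((ac k).2 (b n))).
have rq k j : r k * q j = if j == k then 1 else 0.
  by apply: eq_endo_basis => n; rewrite /= qb rb; case: ifP.
have rc k : r k * c - (ac k).2 \in I.
  apply: (@finite_image_endo_basis _ k) => n kn.
  rewrite /= cb raddf_sum (bigD1 (Ordinal (kn : k < n.+1)%N)) //= big1 => [|j].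
    have /= := congr1 (fun f : endo A => f ((ac k).2 (b n))) (rq k k).
    by rewrite eqxx => ->; rewrite addr0 subrr.
  rewrite -val_eqE /= => /negPf jk.
  by have /= := congr1 (fun f : endo A => f ((ac j).2 (b n))) (rq k j); rewrite jk.
exists (pi a), (pi c) => k.
have piM (x y : endo A) : pi x * pi y = pi (x * y) :> ring_quot I.
  exact: esym (@ring_quot_mulE _ I x y).
rewrite -[z k]reprK -/(pi _).
have -> : pi a * (pi (q k) * pi (repr (z k)) * pi (r k)) * pi c =
  pi (a * q k) * pi (repr (z k)) * pi (r k * c) :> ring_quot I.
  by rewrite -!piM !mulrA.
have -> : pi (r k * c) = pi (ac k).2 by exact/ring_quot_eq.
by rewrite aq !piM acP.
Qed.

End Space.

End Polynomials.

(** * The quotient by the finite-image endomorphisms *)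

(** An endomorphism of a countable group is coded by its graph, a subset of a
    countable set. *)
Lemma surjection_from_subsets_nat (A : zmodType) (I : twoSidedIdeal (endo A)) :
  countable [set: A] ->
  exists s : set nat -> ring_quot I, forall x, exists w, s w = x.
Proof.
move=> /countable_injP[i i_inj].
pose code (x : ring_quot I) : set nat := range (fun a => pickle (i a, i (repr x a))).
have code_inj x y : code x = code y -> x = y.
  move=> xy; rewrite -[x]reprK -[y]reprK; congr (\pi_(ring_quot I) _).
  apply: endoP => a.
  have : code x (pickle (i a, i (repr x a))) by exists a.
  rewrite xy => -[a' _ /(pcan_inj pickleK)[ia ira]].
  have a'a : a' = a by apply: i_inj; rewrite ?inE.
  by symmetry; rewrite -{1}a'a; apply: i_inj; rewrite ?inE.
have /choice[s sP] : forall w, exists x, (exists y, code y = w) -> code x = w.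
  move=> w; have [[x xw]|nw] := pselect (exists y, code y = w); first by exists x.
  by exists 0.
by exists s => x; exists (code x); apply: code_inj; apply: sP; exists x.
Qed.

Theorem theorem4 (p : nat) (A : zmodType) :
  continuum_hypothesis ->
  prime p ->
  elementary_abelian p A ->
  ([set: A] #= [set: nat])%card ->
  ~ admits_nondiscrete_locally_compact_ring_topology
      (ring_quot (finite_image_ideal A)).
Proof.
move=> CH p_pr pA cardA [tau [ringT [crT hT] lcT ndT]].
have [phi phi_bij] := elementary_abelian_poly_iso p_pr pA cardA.
have units := endo_quotient_simultaneous_units p_pr pA phi_bij.
have nz10 : 1 <> 0 :> ring_quot (finite_image_ideal A).
  rewrite -[RHS](@pi_zeror _ _ _ _ _ (ring_quot (finite_image_ideal A))).
  move=> /ring_quot_eq; rewrite subr0 => /finite_image_endoP fin1.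
  apply: (infinite_of_card_nat cardA); apply: sub_finite_set fin1.
  by move=> a _; exists a.
have [|s s_surj] := @surjection_from_subsets_nat A (finite_image_ideal A).
  by move: cardA; rewrite card_eq_le => /andP[].
pose T : topologicalType := Topological.Pack tau.
have [x Gx] := @aleph1_regular_Gdelta_point T Rdefinitions.R _ s
  (0 : ring_quot (finite_image_ideal A)) CH s_surj crT hT lcT.
have [U [xU Ubase]] := regular_Gdelta_point_countable_base hT lcT Gx.
exact: (no_countable_base_of_simultaneous_units ringT nz10 units hT ndT xU Ubase).
Qed.
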